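(* Let $A\in\mathbb{R}^{n\times n}$, $B\in\mathbb{R}^{n\times m}$, $C\in\mathbb{R}^{p\times n}$, $D\in\mathbb{R}^{p\times m}$, $K_I,K_P\in\mathbb{R}^{m\times n}$, $L\in\mathbb{R}^{n\times p}$ with $\operatorname{rank}(A-LC)=n$, let $w\in\mathbb{R}^m$ be a constant disturbance, let $f:\mathbb{R}^n\to\mathbb{R}$ be continuously differentiable and strongly convex with Lipschitz continuous gradient, let $\mathcal{X}^*=\{x\in\mathbb{R}^n:\nabla f(x)=0\}$, and let $\varphi:\mathbb{R}^n\to\mathbb{R}^n$. Consider the interconnected system, with state $(x,\eta)$, $\eta=(\hat x,e_I)\in\mathbb{R}^n\times\mathbb{R}^n$, $$\dot x=Ax+Bu,\qquad y=Cx+Du,\qquad u=r+w,$$ $$\dot{\hat x}=(A-LC)\hat x+(B-LD)u+Ly,\qquad z=\hat x,\qquad e=\varphi(z),\qquad \dot e_I=e,\qquad r=K_Ie_I+K_Pe .$$ Suppose that: (A.1) if the system is in equilibrium, then $z=z_*=x_*$, where $x_*$ is the equilibrium value of $x$; (B.1) for $z\in\mathbb{R}^n$, $\varphi(z)=0$ if and only if $z\in\mathcal{X}^*$; (B.2) $\varphi$ satisfies the pointwise IQC $(Q,z_*,\varphi(z_* ))$ for a matrix $Q\in\mathbb{R}^{2n\times2n}$; (C.1) if the system is in equilibrium, then $e=0$; $(A,B,C,D)$ is a minimal realization (controllable and observable); and for every $x_*\in\mathbb{R}^n$ there exists $u_*\in\mathbb{R}^m$ with $Ax_*+Bu_*=0$.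 Let $(x_*,\eta_* )$ be an equilibrium point of the interconnected system (with $x_*\in\mathcal{X}^*$). Define $$\hat A=\begin{bmatrix} A & 0 & BK_I\\ LC & A-LC & BK_I\\ 0&0&0\end{bmatrix},\qquad \hat B_e=\begin{bmatrix} BK_P\\ BK_P\\ I_n\end{bmatrix},\qquad \hat C=\begin{bmatrix}0& I_n&0\end{bmatrix}.$$ If there exist $\sigma\ge 0$, $\alpha>0$ and a symmetric $P\in\mathbb{R}^{3n\times3n}$, $P\succ0$, such that $$\begin{bmatrix} \hat A^TP+P\hat A+\alpha P & P\hat B_e\\ \hat B_e^TP & 0\end{bmatrix}+\sigma\begin{bmatrix}\hat C^T&0\\0&I_n\end{bmatrix}Q\begin{bmatrix}\hat C&0\\0&I_n\end{bmatrix}\preceq0,$$ then the equilibrium point $(x_*,\eta_* )$ has global exponential asymptotic stability of at least rate $\alpha$.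
   Context: A mapping $\phi:\mathbb{R}^n\to\mathbb{R}^n$ satisfies the pointwise IQC (integral quadratic constraint) defined by $(Q_\phi,p_*,\phi(p_* ))$, where $Q_\phi=Q_\phi^T\in\mathbb{R}^{2n\times 2n}$ is an indefinite matrix, if $$\begin{bmatrix} p-p_* \\ \phi(p)-\phi(p_* ) \end{bmatrix}^T Q_\phi \begin{bmatrix} p-p_* \\ \phi(p)-\phi(p_* ) \end{bmatrix}\ge 0\quad\text{for all }(p,p_* )\in\mathbb{R}^n\times\mathbb{R}^n.$$ Strong convexity of $f$ means $(\nabla f(p)-\nabla f(q))^T(p-q)\ge m\|p-q\|^2$ for all $p,q$, for some $m>0$. An equilibrium point is a state $(x_*,\hat x_*,e_{I*})$ at which $\dot x=0$, $\dot{\hat x}=0$, $\dot e_I=0$. Convention on rate: an equilibrium $\xi_*$ has global exponential asymptotic stability of at least rate $\alpha$ if the rate is measured by a quadratic Lyapunov function, i.e. there is a constant $c>0$ such that every solution $\xi(t)$ satisfies $\|\xi(t)-\xi_*\|^2\le c\,e^{-\alpha t}\|\xi(0)-\xi_*\|^2$ for all $t\ge0$ for which it is defined. Here $\xi=(x,\hat x,e_I)$. *)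

(* Defs.v *)
(* MathComp + MathComp-Analysis. *)
From HB Require Import structures.
From mathcomp Require Import all_boot all_order all_algebra.
From mathcomp Require Import all_classical all_reals all_analysis.

Set Implicit Arguments.
Unset Strict Implicit.
Unset Printing Implicit Defensive.

Import Order.TTheory GRing.Theory Num.Theory numFieldNormedType.Exports.

Local Open Scope classical_set_scope.
Local Open Scope ring_scope.

(* The library norm on matrices is the sup norm; the norms and products below
   are the Euclidean ones. *)
Definition dotv (R : realType) (k : nat) (u v : 'cV[R]_k) : R :=
  (u^T *m v) 0 0.

Definition sqnorm (R : realType) (k : nat) (v : 'cV[R]_k) : R := dotv v v.

Definition enorm (R : realType) (k : nat) (v : 'cV[R]_k) : R :=
  Num.sqrt (sqnorm v).

Definition qform (R : realType) (k : nat) (M : 'M[R]_k) (v : 'cV[R]_k) : R :=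
  (v^T *m M *m v) 0 0.

Definition posdef (R : realType) (k : nat) (M : 'M[R]_k) : Prop :=
  forall v : 'cV[R]_k, v != 0 -> 0 < qform M v.

Definition possemidef (R : realType) (k : nat) (M : 'M[R]_k) : Prop :=
  forall v : 'cV[R]_k, 0 <= qform M v.

Definition negsemidef (R : realType) (k : nat) (M : 'M[R]_k) : Prop :=
  forall v : 'cV[R]_k, qform M v <= 0.

Definition indefinite (R : realType) (k : nat) (M : 'M[R]_k) : Prop :=
  ~ possemidef M /\ ~ negsemidef M.

Definition gradient (R : realType) (n : nat) (f : 'cV[R]_n -> R)
    (x : 'cV[R]_n) : 'cV[R]_n :=
  \col_(i < n) 'D_(delta_mx i 0) f x.

Definition continuously_differentiable (R : realType) (n : nat)
    (f : 'cV[R]_n -> R) : Prop :=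
  (forall x : 'cV[R]_n, differentiable f x) /\ continuous (gradient f).

Definition strongly_convex (R : realType) (n : nat) (f : 'cV[R]_n -> R) : Prop :=
  exists2 mu : R, 0 < mu & forall p q : 'cV[R]_n,
    mu * enorm (p - q) ^+ 2 <= dotv (gradient f p - gradient f q) (p - q).

Definition lipschitz_gradient (R : realType) (n : nat)
    (f : 'cV[R]_n -> R) : Prop :=
  exists2 l : R, 0 <= l & forall p q : 'cV[R]_n,
    enorm (gradient f p - gradient f q) <= l * enorm (p - q).

Definition critical_set (R : realType) (n : nat) (f : 'cV[R]_n -> R) :
    set 'cV[R]_n :=
  [set x | gradient f x = 0].

(* The inequality is imposed for all pairs p, ps, so the reference point is
   not a parameter. *)
Definition pointwise_IQC (R : realType) (n : nat) (Q : 'M[R]_(n + n))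
    (phi : 'cV[R]_n -> 'cV[R]_n) : Prop :=
  [/\ Q^T = Q,
      indefinite Q
    & forall p ps : 'cV[R]_n, 0 <= qform Q (col_mx (p - ps) (phi p - phi ps))].

(* Solution of v' = F t v on an interval J: continuous on J, with the equation
   holding in the interior of J; the values of v outside J are irrelevant. *)
Definition is_solution (R : realType) (k : nat) (F : R -> 'cV[R]_k -> 'cV[R]_k)
    (J : set R) (v : R -> 'cV[R]_k) : Prop :=
  {within J, continuous v} /\
  forall t : R, interior J t -> is_derive t (1 : R) v (F t (v t)).

Definition lti_trajectory (R : realType) (n m : nat) (A : 'M[R]_n)
    (B : 'M[R]_(n, m)) (T : R) (u : R -> 'cV[R]_m) (x : R -> 'cV[R]_n) : Prop :=
  {within `[0, T], continuous u} /\
  is_solution (fun t v => A *m v + B *m u t) `[0, T] x.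

Definition controllable (R : realType) (n m : nat) (A : 'M[R]_n)
    (B : 'M[R]_(n, m)) : Prop :=
  forall x0 x1 : 'cV[R]_n, exists (T : R) (u : R -> 'cV[R]_m)
      (x : R -> 'cV[R]_n),
    [/\ 0 < T, lti_trajectory A B T u x, x 0 = x0 & x T = x1].

Definition observable (R : realType) (n m p : nat) (A : 'M[R]_n)
    (B : 'M[R]_(n, m)) (C : 'M[R]_(p, n)) (D : 'M[R]_(p, m)) : Prop :=
  exists2 T : R, 0 < T &
    forall (u : R -> 'cV[R]_m) (x x' : R -> 'cV[R]_n),
      lti_trajectory A B T u x -> lti_trajectory A B T u x' ->
      (forall t : R, 0 <= t <= T ->
         C *m x t + D *m u t = C *m x' t + D *m u t) ->
      x 0 = x' 0.

Definition minimal_realization (R : realType) (n m p : nat) (A : 'M[R]_n)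
    (B : 'M[R]_(n, m)) (C : 'M[R]_(p, n)) (D : 'M[R]_(p, m)) : Prop :=
  controllable A B /\ observable A B C D.

(* States of the closed loop are stacked as xi = col_mx x (col_mx xhat eI). *)
Section ClosedLoop.
Variables (R : realType) (n m p : nat).
Variables (A : 'M[R]_n) (B : 'M[R]_(n, m)).
Variables (C : 'M[R]_(p, n)) (D : 'M[R]_(p, m)).
Variables (KI KP : 'M[R]_(m, n)) (L : 'M[R]_(n, p)).
Variables (w : 'cV[R]_m) (phi : 'cV[R]_n -> 'cV[R]_n).

Implicit Type xi : 'cV[R]_(n + (n + n)).

Definition state_x xi : 'cV[R]_n := usubmx xi.
Definition state_xhat xi : 'cV[R]_n := usubmx (dsubmx xi).
Definition state_eI xi : 'cV[R]_n := dsubmx (dsubmx xi).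

Definition signal_z xi : 'cV[R]_n := state_xhat xi.
Definition signal_e xi : 'cV[R]_n := phi (signal_z xi).
Definition signal_r xi : 'cV[R]_m := KI *m state_eI xi + KP *m signal_e xi.
Definition signal_u xi : 'cV[R]_m := signal_r xi + w.
Definition signal_y xi : 'cV[R]_p := C *m state_x xi + D *m signal_u xi.

Definition closed_loop xi : 'cV[R]_(n + (n + n)) :=
  col_mx (A *m state_x xi + B *m signal_u xi)
    (col_mx ((A - L *m C) *m state_xhat xi + (B - L *m D) *m signal_u xi
             + L *m signal_y xi)
            (signal_e xi)).

Definition is_equilibrium xi : Prop := closed_loop xi = 0.

Definition Ahat : 'M[R]_(n + (n + n)) :=
  block_mx A           (row_mx 0 (B *m KI))
           (col_mx (L *m C) 0) (block_mx (A - L *m C) (B *m KI) 0 0).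

Definition Bhat : 'M[R]_(n + (n + n), n) :=
  col_mx (B *m KP) (col_mx (B *m KP) 1%:M).

Definition Chat : 'M[R]_(n, n + (n + n)) := row_mx 0 (row_mx 1%:M 0).

Definition lmi_matrix (Q : 'M[R]_(n + n)) (P : 'M[R]_(n + (n + n)))
    (alpha sigma : R) : 'M[R]_((n + (n + n)) + n) :=
  block_mx (Ahat^T *m P + P *m Ahat + alpha *: P) (P *m Bhat)
           (Bhat^T *m P)                          0
  + sigma *: (block_mx Chat^T 0 0 1%:M *m Q *m block_mx Chat 0 0 1%:M).

End ClosedLoop.

(* Since the vector field need not be continuous, no existence of solutions is
   assumed: the bound, with a constant uniform in the solution, is required on
   whatever interval J containing 0 a solution is defined. *)
Definition globally_exp_stable (R : realType) (k : nat)
    (F : 'cV[R]_k -> 'cV[R]_k) (xis : 'cV[R]_k) (alpha : R) : Prop :=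
  exists2 c : R, 0 < c &
    forall (J : set R) (xi : R -> 'cV[R]_k),
      is_interval J -> J 0 -> is_solution (fun=> F) J xi ->
      forall t : R, J t -> 0 <= t ->
        enorm (xi t - xis) ^+ 2
          <= c * expR (- alpha * t) * enorm (xi 0 - xis) ^+ 2.

(* Main.v *)
(* The function V(xi) = (xi - xi_* )^T P (xi - xi_* ) is a Lyapunov function.
   Along a solution, d/dt (xi - xi_* ) = Ahat (xi - xi_* ) + Bhat d with
   d = phi z - phi z_*, so evaluating the matrix inequality at (xi - xi_*, d)
   gives V' + alpha V + sigma q <= 0, where q, the value of the quadratic form
   of Q at (z - z_*, d), is nonnegative by the pointwise IQC. Hence
   exp (alpha t) V(xi t) is nonincreasing, and V is comparable with the squared
   Euclidean distance to xi_*. *)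
Require Import Defs.
From HB Require Import structures.
From mathcomp Require Import all_boot all_order all_algebra.
From mathcomp Require Import all_classical all_reals all_analysis.
From mathcomp Require Import ring lra.

Set Implicit Arguments.
Unset Strict Implicit.
Unset Printing Implicit Defensive.

Import Order.TTheory GRing.Theory Num.Theory numFieldNormedType.Exports.
Local Open Scope classical_set_scope.
Local Open Scope ring_scope.

(** * Quadratic forms compared with the Euclidean norm *)

Lemma qformE (R : realType) (k : nat) (M : 'M[R]_k) (v : 'cV[R]_k) :
  qform M v = \sum_i \sum_j v j 0 * M j i * v i 0.
Proof.
rewrite /qform mxE; apply: eq_bigr => i _; rewrite mxE mulr_suml.
by apply: eq_bigr => j _; rewrite mxE.
Qed.

Lemma sqnormE (R : realType) (k : nat) (v : 'cV[R]_k) :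
  sqnorm v = \sum_i v i 0 ^+ 2.
Proof.
by rewrite /sqnorm /dotv mxE; apply: eq_bigr => i _; rewrite mxE expr2.
Qed.

Lemma sqnorm_ge0 (R : realType) (k : nat) (v : 'cV[R]_k) : 0 <= sqnorm v.
Proof. by rewrite sqnormE; apply: sumr_ge0 => i _; rewrite sqr_ge0. Qed.

Lemma sqr_enorm (R : realType) (k : nat) (v : 'cV[R]_k) :
  enorm v ^+ 2 = sqnorm v.
Proof. by rewrite sqr_sqrtr ?sqnorm_ge0. Qed.

Lemma ler_entry_enorm (R : realType) (k : nat) (v : 'cV[R]_k) (i : 'I_k) :
  `|v i 0| <= enorm v.
Proof.
rewrite -sqrtr_sqr ler_wsqrtr// sqnormE (bigD1 i)//= lerDl.
by apply: sumr_ge0 => j _; rewrite sqr_ge0.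
Qed.

Lemma qform_le_sqnorm (R : realType) (k : nat) (M : 'M[R]_k) :
  exists2 c : R, 0 < c & forall v : 'cV[R]_k, qform M v <= c * sqnorm v.
Proof.
have Sge0 : 0 <= \sum_i \sum_j `|M j i|.
  by apply: sumr_ge0 => i _; apply: sumr_ge0.
(* Each term [v j 0 * M j i * v i 0] is at most [|M j i|] times the squared norm; the added 1 keeps
   the constant positive even when [M] is zero. *)
exists (1 + \sum_i \sum_j `|M j i|); first by rewrite ltr_pwDl.
move=> v; rewrite mulrDl mul1r ler_wpDl ?sqnorm_ge0// qformE mulr_suml.
apply: ler_sum => i _; rewrite mulr_suml; apply: ler_sum => j _.
apply: le_trans (ler_norm _) _.
rewrite mulrAC !normrM mulrC ler_wpM2l//.
by rewrite -sqr_enorm expr2 ler_pM// ler_entry_enorm.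
Qed.

Lemma posdef_unitmx (R : realType) (k : nat) (P : 'M[R]_k) :
  posdef P -> P \in unitmx.
Proof.
move=> posP; rewrite -row_free_unit -kermx_eq0.
apply/rowV0P => u /sub_kermxP uP.
apply/eqP; apply: contraT => u_neq0.
have /posP : u^T != 0 by rewrite -trmx0 (inj_eq trmx_inj).
by rewrite /qform trmxK uP mul0mx mxE ltxx.
Qed.

Lemma dotvC (R : realType) (k : nat) (u v : 'cV[R]_k) : dotv u v = dotv v u.
Proof. by rewrite /dotv !mxE; apply: eq_bigr => i _; rewrite !mxE mulrC. Qed.

Lemma dotvDr (R : realType) (k : nat) (u v w : 'cV[R]_k) :
  dotv u (v + w) = dotv u v + dotv u w.
Proof. by rewrite /dotv mulmxDr mxE. Qed.

Lemma dotvBr (R : realType) (k : nat) (u v w : 'cV[R]_k) :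
  dotv u (v - w) = dotv u v - dotv u w.
Proof. by rewrite /dotv mulmxBr mxE [X in _ + X]mxE. Qed.

Lemma dotvZr (R : realType) (k : nat) (a : R) (u v : 'cV[R]_k) :
  dotv u (a *: v) = a * dotv u v.
Proof. by rewrite /dotv -scalemxAr mxE. Qed.

Lemma dotv_mulmx (R : realType) (k l : nat) (M : 'M[R]_(k, l)) (u : 'cV[R]_k)
    (v : 'cV[R]_l) : dotv u (M *m v) = dotv (M^T *m u) v.
Proof. by rewrite /dotv trmx_mul trmxK mulmxA. Qed.

Lemma dotv_col_mx (R : realType) (k l : nat) (u1 v1 : 'cV[R]_k)
    (u2 v2 : 'cV[R]_l) :
  dotv (col_mx u1 u2) (col_mx v1 v2) = dotv u1 v1 + dotv u2 v2.
Proof. by rewrite /dotv tr_col_mx mul_row_col mxE. Qed.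

Lemma qform_dotv (R : realType) (k : nat) (M : 'M[R]_k) (v : 'cV[R]_k) :
  qform M v = dotv v (M *m v).
Proof. by rewrite /qform /dotv mulmxA. Qed.

(** This stands in for a bound by the smallest eigenvalue: the upper bound on the form of [invmx P]
    yields the lower bound on that of [P] with the same constant, without spectral theory or
    compactness. *)
Lemma sqnorm_le_qform (R : realType) (k : nat) (P : 'M[R]_k) :
  P^T = P -> posdef P ->
  exists2 c : R, 0 < c & forall v : 'cV[R]_k, sqnorm v <= c * qform P v.
Proof.
move=> symP posP; have uP := posdef_unitmx posP.
have [c c0 cP] := qform_le_sqnorm (invmx P).
exists c => // v; set w := invmx P *m v.
have Pw : P *m w = v by rewrite mulmxA mulmxV// mul1mx.
(* Expanding [0 <= qform P (c v - P^-1 v)] gives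
   [0 <= c^2 qform P v - 2 c |v|^2 + qform P^-1 v], where the last term is at
   most [c |v|^2]. *)
have : 0 <= qform P (c *: v - w).
  have [->|/posP/ltW//] := eqVneq (c *: v - w) 0.
  by rewrite /qform mulmx0 mxE.
have wPv : dotv w (P *m v) = sqnorm v by rewrite dotv_mulmx symP Pw.
rewrite qform_dotv mulmxBr -scalemxAr Pw dotvBr dotvZr.
rewrite !(dotvC (_ - _)) !dotvBr !dotvZr !(dotvC _ w) wPv (dotvC (P *m v)).
rewrite -qform_dotv -/(sqnorm v) (dotvC w) -qform_dotv.
have Pv := cP v => cv_ge0.
by rewrite -(ler_pM2l c0); nra.
Qed.

(** * Quadratic Lyapunov functions along solutions *)

Lemma is_derive_qform (R : realType) (k : nat) (P : 'M[R]_k) (c : 'cV[R]_k)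
    (x : R -> 'cV[R]_k) (dx : 'cV[R]_k) (t : R) :
  P^T = P -> is_derive t (1 : R) x dx ->
  is_derive t (1 : R) (fun s => qform P (x s - c))
    (dotv (P *m (x t - c)) dx *+ 2).
Proof.
move=> symP [dx_x dxE].
have dxi i : is_derive t (1 : R) (fun s => x s i 0 - c i 0) (dx i 0).
  have dxi : is_derive t (1 : R) (fun s => x s i 0) (dx i 0).
    split; first by move/derivable_mxP : dx_x; apply.
    by rewrite -dxE derive_mx// mxE.
  rewrite -[dx i 0]subr0.
  exact: is_deriveB.
have -> : (fun s => qform P (x s - c)) =
    \sum_i \sum_j (fun s => P j i * ((x s j 0 - c j 0) * (x s i 0 - c i 0))).
  apply/funext => s; rewrite qformE fct_sumE; apply: eq_bigr => i _.
  rewrite fct_sumE; apply: eq_bigr => j _.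
  by rewrite !mxE; ring.
have -> : dotv (P *m (x t - c)) dx *+ 2 =
    \sum_i \sum_j P j i *: ((x t j 0 - c j 0) *: dx i 0
                          + (x t i 0 - c i 0) *: dx j 0).
  (* The product rule gives two double sums. Each equals [dotv (P *m u) dx]: the first by exchanging
     the summations, the second by symmetry of [P]. *)
  have dotvPE1 (u : 'cV[R]_k) :
      dotv (P *m u) dx = \sum_i \sum_j P j i * (u i 0 * dx j 0).
    rewrite /dotv mxE exchange_big; apply: eq_bigr => i _.
    by rewrite !mxE mulr_suml; apply: eq_bigr => j _; rewrite mulrA.
  have dotvPE2 (u : 'cV[R]_k) :
      dotv (P *m u) dx = \sum_i \sum_j P j i * (u j 0 * dx i 0).
    rewrite /dotv mxE; apply: eq_bigr => i _.
    rewrite !mxE mulr_suml; apply: eq_bigr => j _.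
    by rewrite -{1}symP mxE mulrA.
  rewrite mulr2n {1}dotvPE2 dotvPE1 -big_split; apply: eq_bigr => i _.
  rewrite -big_split; apply: eq_bigr => j _ /=.
  by rewrite !mxE -mulrDr.
apply: is_derive_sum => i; apply: is_derive_sum => j.
apply: is_deriveZ.
exact: is_deriveM.
Qed.

(** The domain is an arbitrary topological space so that it can be [[0, t]] with its subspace
    topology. *)
Lemma continuous_qform (R : realType) (k : nat) (P : 'M[R]_k) (c : 'cV[R]_k)
    (T : topologicalType) (x : T -> 'cV[R]_k) :
  continuous x -> continuous (fun s => qform P (x s - c)).
Proof.
move=> cx.
have -> : (fun s => qform P (x s - c)) =
    (fun s => \sum_i \sum_j (x s j 0 - c j 0) * P j i * (x s i 0 - c i 0)).
  apply/funext => s; rewrite qformE; apply: eq_bigr => i _.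
  by apply: eq_bigr => j _; rewrite !mxE.
have cc i : continuous (fun s => x s i 0 - c i 0).
  move=> s; apply: cvgB; last exact: cvg_cst.
  exact: (continuous_comp (cx s) (@coord_continuous R k 1 i 0 (x s))).
have cM i j :
    continuous (fun s => (x s j 0 - c j 0) * P j i * (x s i 0 - c i 0)).
  by move=> s; apply: cvgM; [apply: cvgMr_tmp|]; exact: cc.
apply: (continuous_big (@add_continuous R^o)) => i _.
by apply: (continuous_big (@add_continuous R^o)) => j _; exact: cM.
Qed.

(* The left-hand side of the hypothesis is [V' + alpha V] along solutions,
   for the Lyapunov function [V v = qform P (v - xis)]. *)
Lemma quadratic_lyapunov_exp_stable (R : realType) (k : nat)
    (F : 'cV[R]_k -> 'cV[R]_k) (xis : 'cV[R]_k) (P : 'M[R]_k) (alpha : R) :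
  P^T = P -> posdef P ->
  (forall v : 'cV[R]_k,
     dotv (P *m (v - xis)) (F v) *+ 2 + alpha * qform P (v - xis) <= 0) ->
  globally_exp_stable F xis alpha.
Proof.
move=> symP posP dissip.
have [a a0 Pa] := sqnorm_le_qform symP posP.
have [b b0 Pb] := qform_le_sqnorm P.
exists (a * b); first exact: mulr_gt0.
move=> J xi itvJ J0 [cxi dxi] t Jt t0.
(* The exponential weight turns the decay of V into monotonicity, since W' = exp (alpha s) (V' +
   alpha V) <= 0. *)
pose W s := expR (alpha * s) * qform P (xi s - xis).
have sub0t : `[0, t] `<=` J.
  by move=> s /=; rewrite in_itv/=; exact: itvJ.
have dW s : s \in `]0, t[%R -> is_derive s (1 : R) W
    (expR (alpha * s) * (dotv (P *m (xi s - xis)) (F (xi s)) *+ 2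
      + alpha * qform P (xi s - xis))).
  (* The differential equation is only available in the interior of [J], which contains the open
     interval from 0 to t. *)
  move=> s0t; have Js : J° s.
    apply: (interiorS sub0t); rewrite interior_itv.
    exact: s0t.
  have dq := is_derive_qform xis symP (dxi s Js).
  have de : is_derive s (1 : R) (fun s => expR (alpha * s))
      (alpha * expR (alpha * s)).
    rewrite mulrC; apply: is_derive1_comp.
    rewrite -[X in is_derive _ _ _ X]mulr1.
    exact: (is_deriveZ alpha (is_derive_id s 1)).
  apply: (is_derive_eq (is_deriveM de dq)).
  by rewrite /GRing.scale/=; ring.
have cW : {within `[0, t], continuous W}.
  have ce : continuous (fun s : R => expR (alpha * s)).
    move=> s; apply: continuous_comp; last exact: continuous_expR.
    exact: mulrl_continuous.
  have cq := @continuous_qform R k P xis _ _ (continuous_subspaceW sub0t cxi).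
  have cE := continuous_subspaceT (A := `[0, t]) ce.
  exact: (fun s => continuousM (cE s) (cq s)).
have Wle : W t <= W 0.
  have dW' s : s \in `]0, t[%R -> derivable W s 1 by move=> /dW; case.
  apply: (ler0_derive1_le_cc dW' _ cW) => //; rewrite ?in_itv/= ?lexx ?t0//.
  move=> s /dW dWs; rewrite derive1E derive_val.
  by rewrite mulr_ge0_le0 ?expR_ge0.
(* The chain is |xi t - xis|^2 <= a V(t) = a exp (- alpha t) W(t) <= a exp (- alpha t) W(0), with
   W(0) = V(0) <= b |xi 0 - xis|^2. *)
rewrite !sqr_enorm; apply: le_trans (Pa _) _.
rewrite -!mulrA (ler_pM2l a0).
have -> : qform P (xi t - xis) = expR (- alpha * t) * W t.
  by rewrite /W mulrA -expRD mulNr addNr expR0 mul1r.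
rewrite [leRHS]mulrCA (ler_pM2l (expR_gt0 _)).
by rewrite (le_trans Wle)// /W mulr0 expR0 mul1r.
Qed.

(** * The closed loop and the matrix inequality *)

Lemma qformD (R : realType) (k : nat) (M N : 'M[R]_k) (v : 'cV[R]_k) :
  qform (M + N) v = qform M v + qform N v.
Proof. by rewrite !qform_dotv mulmxDl dotvDr. Qed.

Lemma qformZ (R : realType) (k : nat) (a : R) (M : 'M[R]_k) (v : 'cV[R]_k) :
  qform (a *: M) v = a * qform M v.
Proof. by rewrite !qform_dotv -scalemxAl dotvZr. Qed.

Lemma qform_congr (R : realType) (k l : nat) (M : 'M[R]_(l, k)) (N : 'M[R]_l)
    (v : 'cV[R]_k) : qform (M^T *m N *m M) v = qform N (M *m v).
Proof. by rewrite /qform trmx_mul !mulmxA. Qed.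

Section ClosedLoopForms.
Variables (R : realType) (n m p : nat).
Variables (A : 'M[R]_n) (B : 'M[R]_(n, m)).
Variables (C : 'M[R]_(p, n)) (D : 'M[R]_(p, m)).
Variables (KI KP : 'M[R]_(m, n)) (L : 'M[R]_(n, p)).
Variables (w : 'cV[R]_m) (phi : 'cV[R]_n -> 'cV[R]_n).

(** The nonlinearity enters only through [e] and the disturbance only through a constant, so both
    the linear part and the constant are easy to handle in differences of the vector field. *)
Lemma closed_loopE (xi : 'cV[R]_(n + (n + n))) :
  closed_loop A B C D KI KP L w phi xi =
  Ahat A B C KI L *m xi + Bhat B KP *m signal_e phi xi
  + col_mx (B *m w) (col_mx (B *m w) 0).
Proof.
rewrite /closed_loop /signal_y /signal_u /signal_r; set e := signal_e phi xi.
set x := state_x xi; set z := state_xhat xi; set u := _ + w.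
have -> : Ahat A B C KI L *m xi = col_mx (A *m x + B *m KI *m state_eI xi)
    (col_mx (L *m C *m x + ((A - L *m C) *m z + B *m KI *m state_eI xi)) 0).
  rewrite -{1}[xi]vsubmxK -{1}[dsubmx xi]vsubmxK /Ahat.
  rewrite mul_block_col mul_block_col mul_row_col mul_col_mx !mul0mx.
  by rewrite add_col_mx !addr0 add0r.
have Bu : B *m u = B *m KI *m state_eI xi + B *m KP *m e + B *m w.
  by rewrite !mulmxDr !mulmxA.
rewrite /Bhat !mul_col_mx mul1mx !add_col_mx add0r addr0.
congr (col_mx _ (col_mx _ _)); first by rewrite Bu !addrA.
(* The term [L *m D *m u] in the measured output cancels the one in [(B - L *m D) *m u]. *)
rewrite mulmxDr !mulmxA addrACA -[X in _ + X]mulmxDl subrK Bu.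
by rewrite [_ + L *m C *m x]addrC !addrA.
Qed.

Lemma Chat_mul (xi : 'cV[R]_(n + (n + n))) : Chat R n *m xi = signal_z xi.
Proof.
rewrite /Chat -{1}[xi]vsubmxK mul_row_col mul0mx add0r.
by rewrite -{1}[dsubmx xi]vsubmxK mul_row_col mul1mx mul0mx addr0.
Qed.

(** For [v] the deviation from equilibrium and [d] that of [e], the first two terms are V' + alpha V
    and the last is the IQC term. Symmetry of [P] merges each pair of transposed blocks into the
    factor 2. *)
Lemma qform_lmi_matrix (Q : 'M[R]_(n + n)) (P : 'M[R]_(n + (n + n)))
    (alpha sigma : R) (v : 'cV[R]_(n + (n + n))) (d : 'cV[R]_n) :
  P^T = P ->
  qform (lmi_matrix A B C KI KP L Q P alpha sigma) (col_mx v d) =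
  dotv (P *m v) (Ahat A B C KI L *m v + Bhat B KP *m d) *+ 2
  + alpha * qform P v + sigma * qform Q (col_mx (signal_z v) d).
Proof.
move=> symP; rewrite /lmi_matrix.
have -> : block_mx (Chat R n)^T 0 0 1%:M =
    (block_mx (Chat R n) 0 0 1%:M)^T :> 'M[R]_(_ + n, n + n).
  by rewrite tr_block_mx !trmx0 trmx1.
rewrite qformD qformZ qform_congr mul_block_col !mul0mx addr0 add0r mul1mx.
rewrite Chat_mul; congr (_ + _).
rewrite qform_dotv mul_block_col dotv_col_mx mul0mx addr0 !mulmxDl !dotvDr.
rewrite -scalemxAl dotvZr -(qform_dotv P) -!mulmxA.
rewrite (dotv_mulmx (Ahat A B C KI L)^T) (dotv_mulmx (Bhat B KP)^T) !trmxK.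
rewrite (dotvC (Ahat _ _ _ _ _ *m v)) (dotvC (Bhat _ _ *m d)).
rewrite !(dotv_mulmx P) symP; ring.
Qed.

End ClosedLoopForms.

Theorem theorem2 (R : realType) (n m p : nat)
    (A : 'M[R]_n) (B : 'M[R]_(n, m)) (C : 'M[R]_(p, n)) (D : 'M[R]_(p, m))
    (KI KP : 'M[R]_(m, n)) (L : 'M[R]_(n, p)) (w : 'cV[R]_m)
    (f : 'cV[R]_n -> R) (phi : 'cV[R]_n -> 'cV[R]_n) (Q : 'M[R]_(n + n))
    (xs : 'cV[R]_n) (etas : 'cV[R]_(n + n))
    (alpha sigma : R) (P : 'M[R]_(n + (n + n))) :
  \rank (A - L *m C) = n ->
  continuously_differentiable f ->
  strongly_convex f ->
  lipschitz_gradient f ->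
  (* (A.1) *)
  (forall xi : 'cV[R]_(n + (n + n)),
     is_equilibrium A B C D KI KP L w phi xi -> signal_z xi = state_x xi) ->
  (* (B.1) *)
  (forall z : 'cV[R]_n, phi z = 0 <-> critical_set f z) ->
  (* (B.2) *)
  pointwise_IQC Q phi ->
  (* (C.1) *)
  (forall xi : 'cV[R]_(n + (n + n)),
     is_equilibrium A B C D KI KP L w phi xi -> signal_e phi xi = 0) ->
  minimal_realization A B C D ->
  (forall x : 'cV[R]_n, exists u : 'cV[R]_m, A *m x + B *m u = 0) ->
  is_equilibrium A B C D KI KP L w phi (col_mx xs etas) ->
  critical_set f xs ->
  0 <= sigma ->
  0 < alpha ->
  P^T = P ->
  posdef P ->
  negsemidef (lmi_matrix A B C KI KP L Q P alpha sigma) ->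
  globally_exp_stable (closed_loop A B C D KI KP L w phi) (col_mx xs etas) alpha.
Proof.
move=> _ _ _ _ _ _ [_ _ iqc] _ _ _ eqs _ sigma0 _ symP posP lmi.
set xis := col_mx xs etas in eqs *.
apply: (quadratic_lyapunov_exp_stable symP posP) => xi.
(* Subtracting the vector field at the equilibrium, where it vanishes, removes the disturbance. *)
have -> : closed_loop A B C D KI KP L w phi xi =
    Ahat A B C KI L *m (xi - xis)
    + Bhat B KP *m (signal_e phi xi - signal_e phi xis).
  rewrite -[LHS]subr0 -[in LHS]eqs !closed_loopE !mulmxBr.
  by rewrite opprD addrACA subrr addr0 opprD addrACA.
(* V' + alpha V is at most the form of the matrix inequality, because the difference is [sigma]
   times the nonnegative IQC form. *)
apply: le_trans (lmi (col_mx (xi - xis) (signal_e phi xi - signal_e phi xis))).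
rewrite qform_lmi_matrix// lerDl mulr_ge0//.
have -> : signal_z (xi - xis) = signal_z xi - signal_z xis.
  by rewrite /signal_z /state_xhat !linearB.
exact: iqc.
Qed.
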